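(* Let $p$ be a prime and let $S$ be a finitely generated pro-$p$ group. Then every group in $\mathcal{E}_{p'}(S)$ is virtually pro-$p$.
   Context: All subgroups of profinite groups are closed, and finite generation is topological. A $p$-Sylow subgroup of a profinite group is a maximal pro-$p$ subgroup. $p'$ denotes the set of primes other than $p$. For a pro-$p$ group $S$, $\mathcal{E}_{p'}(S)$ is the class of profinite groups $G$ that have $S$ as a $p$-Sylow subgroup and have no non-trivial normal pro-$p'$ subgroups. A profinite group is virtually pro-$p$ if it has an open normal pro-$p$ subgroup. *)

(* Defs.v *)
From HB Require Import structures.
From mathcomp Require Import all_boot.
From mathcomp Require Import all_classical topology.

Set Implicit Arguments.
Unset Strict Implicit.
Unset Printing Implicit Defensive.

Local Open Scope classical_set_scope.
Local Open Scope card_scope.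
Local Open Scope group_scope.

HB.mixin Record isTopologicalGroup G of Group G & Topological G := {
  mulg_continuous : continuous (fun xy : G * G => xy.1 * xy.2);
  invg_continuous : continuous (fun x : G => x^-1)
}.

#[short(type="topologicalGroupType")]
HB.structure Definition TopologicalGroup :=
  {G of Group G & Topological G & isTopologicalGroup G}.

Section Profinite.
Variable G : topologicalGroupType.
Implicit Types (H N P Q X : set G) (pi : nat_pred) (p : nat).

Definition profinite : Prop :=
  [/\ compact [set: G], hausdorff_space G & totally_disconnected [set: G]].

Definition subgroup H : Prop := group_closed (mem H).

Definition closed_subgroup H : Prop := subgroup H /\ closed H.

Definition normal_in N H : Prop :=
  [/\ subgroup N, N `<=` H & forall x y, N x -> H y -> N (x ^ y)].

Definition open_in N H : Prop := exists2 U, open U & N = H `&` U.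

Definition left_cosets H N : set (set G) :=
  [set [set x * y | y in N] | x in H].

(* For pi = p (the coercion of p to the predicate "equal to p") this says that
   H is pro-p, and for pi = p^' that H is pro-p'.  The closed subgroups of a
   profinite group are themselves profinite for the induced topology, so being
   pro-pi is a condition on the indices of their relatively open normal
   subgroups. *)
Definition pro_subgroup pi H : Prop :=
  closed_subgroup H /\
  forall N, normal_in N H -> open_in N H ->
    exists2 n, pi.-nat n & left_cosets H N #= `I_n.

Definition sylow_subgroup p P : Prop :=
  pro_subgroup p P /\
  forall Q, pro_subgroup p Q -> P `<=` Q -> Q = P.

Definition generated X : set G := smallest subgroup X.

Definition finitely_generated : Prop :=
  exists2 X, finite_set X & closure (generated X) = [set: G].

Definition virtually_pro p : Prop :=
  exists N, [/\ open N, normal_in N [set: G] & pro_subgroup p N].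

End Profinite.

Arguments profinite G : clear implicits.
Arguments finitely_generated G : clear implicits.
Arguments virtually_pro G p : clear implicits.

Definition pro_group (pi : nat_pred) (G : topologicalGroupType) : Prop :=
  profinite G /\ pro_subgroup pi [set: G].

(* S is isomorphic, as a topological group, to the subgroup P of G carrying the
   topology induced by G. *)
Definition isomorphic_to_subgroup (S G : topologicalGroupType) (P : set G) :
    Prop :=
  exists f : S -> G, exists g : G -> S,
    [/\ {morph f : x y / x * y}, continuous f, {within P, continuous g},
        cancel f g & range f = P].

(* The class E_{p'}(S); "having S as a p-Sylow subgroup" is understood up to
   isomorphism of topological groups. *)
Definition class_E (p : nat) (S G : topologicalGroupType) : Prop :=
  [/\ profinite G,
      exists2 P : set G, sylow_subgroup p P & isomorphic_to_subgroup S P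
    & forall N : set G,
        normal_in N [set: G] -> pro_subgroup p^'%N N -> N = [set 1]].

(* Main.v *)
Require Import Defs.
From mathcomp Require Import all_boot all_fingroup all_solvable.

Set Implicit Arguments.
Unset Strict Implicit.
Unset Printing Implicit Defensive.

(** The open normal pro-p subgroup comes from Tate's theorem on normal
    p-complements.

    A finitely generated S has only finitely many continuous homomorphisms to
    the symmetric group of degree p, so one neighbourhood of 1 lies in every
    open subgroup of index p ([nbhs_in_index_p_subgroups]): for a pro-p group
    this says that the Frattini subgroup is open.  Carry that neighbourhood to
    the Sylow subgroup P of G and choose an open normal subgroup N of G such
    that P meets N inside it.  Let h be a homomorphism from G to a finite
    group whose kernel is open and contained in N.  Then h(P) is a Sylow
    p-subgroup of h(G) ([sylow_image]), and all its subgroups of index p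
    contain its intersection with h(N).  By Tate's theorem
    ([Tate_p'_generated]) the p'-elements of h(N) form a normal p'-subgroup,
    with a p-group as quotient.  Letting h vary, the elements of N that have
    p'-order in every finite quotient form a closed normal pro-p' subgroup of
    G.  It is trivial by hypothesis, and since it is the intersection of a
    directed family of closed sets, compactness shows that every open subgroup
    of N contains the preimage of the p'-elements of some h(N), so that N is
    pro-p ([pro_p_of_trivial_p'_elements]).

    Tate's theorem is proved without cohomology.  Let K be generated by the
    p'-elements of N, put G0 = PN and let Q be the intersection of P and K;
    then G0/K = P/Q.  If Q is not trivial, choose M normal in P and of index p
    in Q.  The projection of G0 onto P/Q lifts to P/M over the Sylow subgroup
    P, hence, by a theorem of Gaschuetz, over G0 ([lift_over_coprime_index]).
    As P/M is a p-group, the lift kills K, so it splits P/M over Q/M; this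
    gives a subgroup of index p in P that does not contain Q, whereas Q is
    contained in the intersection of P and N.

    The Sylow subgroup P is only known to be a maximal pro-p subgroup.  Its
    images are Sylow subgroups because a minimal closed subgroup among those
    that contain P and have an image of p'-index in every finite quotient is
    itself pro-p. *)

Local Open Scope group_scope.

(** * Finite groups: normal p-complements *)

(** The fibre product F of alpha and beta is an extension of G by the kernel of
    beta.  A lift over P is a complement to that kernel in the preimage L of P,
    so Gaschuetz's theorem gives a complement C in F, and C is the graph of a
    lift over G. *)
Lemma lift_over_coprime_index (gT eT rT : finGroupType) (G P : {group gT})
    (E : {group eT}) (alpha : {morphism G >-> rT}) (beta : {morphism E >-> rT})
    (gamma : {morphism P >-> eT}) :
    P \subset G -> alpha @* G \subset beta @* E ->
    gamma @* P \subset E -> {in P, forall x, beta (gamma x) = alpha x} ->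
    abelian ('ker beta) -> coprime #|'ker beta| #|G : P| ->
  exists phi : {morphism G >-> eT},
    phi @* G \subset E /\ {in G, forall x, beta (phi x) = alpha x}.
Proof.
move=> sPG sGE sPE bg abK coK.
have gE x : x \in P -> gamma x \in E.
  by move=> Px; apply: (subsetP sPE); apply: mem_morphim.
pose F := [set u : gT * eT | [&& u.1 \in G, u.2 \in E & alpha u.1 == beta u.2]].
have gF : group_set F.
  apply/group_setP; split; first by rewrite inE !group1 !morph1 eqxx.
  move=> [x a] [y b]; rewrite !inE /= => /and3P[Gx Ea /eqP xa].
  move=> /and3P[Gy Eb /eqP yb]; rewrite !groupM //=.
  by rewrite !morphM // xa yb.
pose Fg := Group gF.
pose fst' : {morphism [set: gT * eT] >-> gT} := [morphism of (@fst gT eT)].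
pose L := (Fg :&: fst' @*^-1 P)%G.
pose H := (Fg :&: 'ker fst')%G.
have LE u : (u \in L) = (u \in F) && (u.1 \in P) by rewrite !inE.
have HE u : (u \in H) = (u \in F) && (u.1 == 1) by rewrite !inE.
have sHL : H \subset L.
  by apply/subsetP => u; rewrite HE LE => /andP[-> /eqP->]; rewrite group1.
have sLF : L \subset Fg by apply: subsetIl.
have nHF : H <| Fg.
  rewrite /normal subsetIl normsI ?normG //.
  by apply: subset_trans (ker_norm _); apply: subsetT.
have FG : fst' @* Fg = G.
  apply/setP=> x; apply/morphimP/idP => [[u _ + ->]|Gx].
    by rewrite inE => /and3P[].
  have /morphimP[a Ea _ xa] : alpha x \in beta @* E.
    by apply: (subsetP sGE); apply: mem_morphim.
  by exists (x, a); rewrite ?inE //= Gx Ea xa eqxx.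
have LP : fst' @* L = P.
  apply/setP=> x; apply/morphimP/idP => [[u _ + ->]|Px].
    by rewrite LE => /andP[].
  exists (x, gamma x); rewrite ?inE //=.
  by rewrite Px (subsetP sPG) // gE // bg // eqxx.
have iFL : #|Fg : L| = #|G : P|.
  rewrite -(index_morphim_ker fst' sLF (subsetT _)) /= FG LP.
  have -> : #|'ker_F fst' : L| = 1%N; last by rewrite muln1.
  have /eqP : #|H : L| == 1%N.
    rewrite indexg_eq1 subsetI subsetIl /= (subset_trans (subsetIr _ _)) //.
    by rewrite morphpreS // sub1G.
  by [].
have HK : H \subset (@pair1g gT eT) @* 'ker beta.
  apply/subsetP => -[x a]; rewrite HE inE /= => /andP[/and3P[Gx Ea /eqP xa]].
  move/eqP=> x1; apply/morphimP; exists a; rewrite ?inE //= ?x1 //.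
  by rewrite Ea -xa x1 morph1 /=.
have abH : abelian H by apply: abelianS HK _; apply: morphim_abelian.
have coH : coprime #|H| #|Fg : L|.
  rewrite iFL; apply: coprime_dvdl coK.
  apply: dvdn_trans (cardSg HK) _; exact: dvdn_morphim.
have spL : [splits L, over H].
  pose d x := (x, gamma x).
  have dM : {in P &, {morph d : x y / x * y}}.
    by move=> x y Px Py; rewrite /d morphM.
  apply/splitsP; exists (Morphism dM @* P)%G.
  apply/complP; split.
    apply/trivgP/subsetP => u; rewrite inE HE => /andP[/andP[_ /eqP u1]].
    case/morphimP=> x Px _ ux; move: u1; rewrite ux /= => ->.
    by rewrite /d morph1 inE.
  apply/eqP; rewrite eqEsubset mul_subG //=; last first.
    apply/subsetP=> _ /morphimP[x Px _ ->].
    by rewrite LE inE /= Px (subsetP sPG) // gE // bg // eqxx.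
  apply/subsetP => -[x a]; rewrite LE inE /=.
  case/andP=> /and3P[Gx Ea /eqP xa] Px.
  apply/mulsgP; exists (1, a * (gamma x)^-1) (d x).
  - rewrite HE inE /= group1 eqxx groupM ?groupV ?gE //= morph1.
    by rewrite morphM ?morphV ?groupV ?gE //= bg // xa mulgV eqxx.
  - by apply/morphimP; exists x.
  - by apply/eqP; rewrite xpair_eqE /= mul1g mulgKV !eqxx.
have /splitsP[C /complP[HC FC]] : [splits Fg, over H].
  by rewrite (Gaschutz_split nHF sHL sLF abH coH).
have FCE u : (u \in F) = (u \in H * C) by rewrite FC.
have CF u : u \in C -> u \in F.
  by move=> Cu; rewrite FCE; apply/mulsgP; exists 1 u; rewrite ?mul1g.
have C1 a b x : (x, a) \in C -> (x, b) \in C -> a = b.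
  move=> Ca Cb; apply/eqP; rewrite eq_mulgV1; apply/eqP.
  have Cab : (x, a) * (x, b)^-1 \in C by rewrite groupM ?groupV.
  have : (x, a) * (x, b)^-1 \in H :&: C.
    by rewrite inE Cab HE CF //= mulgV eqxx.
  by rewrite HC => /set1P[].
have exC x : x \in G -> exists a, (x, a) \in C.
  rewrite -FG => /morphimP[u _ + ->]; rewrite /= FCE.
  case/mulsgP=> h c; rewrite HE => /andP[_ /eqP h1] Cc ->.
  by exists c.2; rewrite /= h1 mul1g -surjective_pairing.
pose phi x := odflt 1 [pick a | (x, a) \in C].
have phiC x : x \in G -> (x, phi x) \in C.
  move=> /exC[a Ca]; rewrite /phi; case: pickP => [//|/(_ a)].
  by rewrite Ca.
have phiM : {in G &, {morph phi : x y / x * y}}.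
  move=> x y Gx Gy; apply: (C1 _ _ (x * y)); first by rewrite phiC ?groupM.
  by have := groupM (phiC x Gx) (phiC y Gy).
exists (Morphism phiM); split.
  apply/subsetP => _ /morphimP[x Gx _ ->].
  by have := CF _ (phiC x Gx); rewrite inE => /and3P[].
by move=> x Gx; have := CF _ (phiC x Gx); rewrite inE => /and3P[_ _ /eqP].
Qed.

Section P'Generated.
Variables (p : nat) (gT : finGroupType) (N : {group gT}).

(** This is the subgroup usually denoted by O^p(N). *)
Definition p'_generated : {group gT} := <<[set x in N | p^'.-elt x]>>%G.

Lemma p'_generated_sub : p'_generated \subset N.
Proof. by rewrite gen_subG; apply/subsetP => x; rewrite inE => /andP[]. Qed.

Lemma p'_generated_normal (G : {group gT}) : N <| G -> p'_generated <| G.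
Proof.
move=> /andP[sNG nNG]; rewrite /normal (subset_trans p'_generated_sub) //=.
apply: norms_gen.
apply/subsetP => g Gg; rewrite inE; apply/subsetP => _ /imsetP[x + ->].
rewrite !inE => /andP[Nx px]; rewrite memJ_norm ?Nx /p_elt ?orderJ //.
exact: (subsetP nNG).
Qed.

(** An element of the quotient is the image of x, hence of the p-part of x,
    because the p'-part of x lies in the subgroup factored out. *)
Lemma p'_generated_quotient : p.-group (N / p'_generated).
Proof.
apply/pgroupP => q q_pr /Cauchy[// | xb].
case/morphimP => x nKx Nx -> oq.
have /constt1P : (coset p'_generated x).`_p^' = 1.
  rewrite -morph_constt //; apply: coset_id; apply: mem_gen.
  by rewrite inE p_elt_constt (subsetP _ _ (cycle_constt _ _)) // cycle_subG.
by rewrite /p_elt pnatNK oq pnatE.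
Qed.

End P'Generated.

(** If K = O^p(N) had a nontrivial Sylow p-subgroup Q, the lift phi of the
    projection of PN onto PN / K = P / Q to a quotient P / M, with M of index
    p in Q, would kill K; its image would be a complement to Q / M in P / M,
    so the preimage of that image in P has index p and does not contain Q. *)
Lemma Tate_p'_generated (p : nat) (gT : finGroupType) (G P N : {group gT}) :
    prime p -> p.-Sylow(G) P -> N <| G ->
    (forall M : {group gT}, M \subset P -> #|P : M| = p -> P :&: N \subset M) ->
  p^'.-group (p'_generated p N).
Proof.
move=> p_pr sylP nNG idxp.
pose K := p'_generated p N; rewrite -/K.
have [sPG pP _] := and3P sylP; have [sNG nNG'] := andP nNG.
have sKN : K \subset N := p'_generated_sub p N.
have nKG : K <| G := p'_generated_normal p nNG.
pose G0 := (P <*> N)%G.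
have G0E : G0 = P * N :> {set _}.
  by rewrite /= norm_joinEl // (subset_trans sPG).
have sG0G : G0 \subset G by rewrite join_subG sPG.
have sPG0 : P \subset G0 by apply: joing_subl.
have sKG0 : K \subset G0 by apply: subset_trans sKN _; apply: joing_subr.
have nKG0 : K <| G0 by apply: normalS sKG0 sG0G nKG.
have sylP0 : p.-Sylow(G0) P by apply: pHall_subl sylP.
have pNK : p.-group (N / K) := p'_generated_quotient _ _.
have pG0K : p.-group (G0 / K).
  rewrite G0E quotientMl ?(subset_trans sPG (normal_norm nKG)) //.
  by rewrite pgroupM pNK andbT quotient_pgroup.
have sylQ : p.-Sylow(K) (P :&: K) by exact: Hall_setI_normal nKG0 sylP0.
pose Q := (P :&: K)%G.
have nQP : Q <| P.
  by rewrite /normal subsetIl normsI ?normG // (subset_trans sPG0) ?normal_norm.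
have pQ : p.-group Q := pgroupS (subsetIl _ _) pP.
have [Q1|ntQ] := eqVneq #|Q| 1%N.
  by rewrite /pgroup -partn_eq1 // -(card_Hall sylQ) Q1.
have [|_ _ [r oQ]] := pgroup_pdiv pQ; first by rewrite trivg_card1.
have [M [sMQ nMP oM]] : exists M : {group gT},
    [/\ M \subset Q, M <| P & #|M| = (p ^ r)%N].
  by apply: normal_pgroup pP nQP _; rewrite oQ pfactorK.
have sPNM : P \subset 'N(M) := normal_norm nMP.
have sPNK : P \subset 'N(K) := subset_trans sPG0 (normal_norm nKG0).
pose q := [morphism of restrm sPNM (coset M)].
pose f := [morphism of restrm sPNK (coset K)].
pose alpha := [morphism of restrm (normal_norm nKG0) (coset K)].
have kerq : 'ker q = M.
  by rewrite ker_restrm ker_coset; apply/setIidPr/(normal_sub nMP).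
have kerf : 'ker f = Q by rewrite ker_restrm ker_coset.
have skqf : 'ker q \subset 'ker f by rewrite kerq kerf.
pose beta := [morphism of factm skqf (subxx P)].
pose E := (q @* P)%G.
have kerb : 'ker beta = q @* Q by rewrite ker_factm kerf.
have okb : #|'ker beta| = p.
  rewrite kerb card_morphim kerq (setIidPr (normal_sub nQP)).
  rewrite -divgS // oQ oM expnS mulnK //.
  by rewrite expn_gt0 prime_gt0.
have bE : beta @* E = f @* P by rewrite morphim_factm.
have aE : alpha @* G0 = f @* P.
  rewrite !morphim_restrm !setIid; apply/esym/pHall_id; last exact: pG0K.
  exact: quotient_pHall sPNK sylP0.
have [|||||phi [phiE phib]] :=
  @lift_over_coprime_index _ _ _ G0 P E alpha beta q sPG0.
- by rewrite aE bE.
- by [].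
- by move=> x Px; exact: (factmE skqf (subxx P) Px).
- by rewrite cyclic_abelian // prime_cyclic // okb.
- rewrite okb prime_coprime // -p'natE //.
  by have /and3P[] := sylP0.
have pE : p.-group E by apply: morphim_pgroup.
(* K is generated by p'-elements and the target of phi is a p-group. *)
have sKphi : K \subset 'ker phi.
  rewrite gen_subG; apply/subsetP => x Ax.
  have G0x : x \in G0 by apply: (subsetP sKG0); apply: mem_gen.
  move: Ax; rewrite inE => /andP[_ p'x].
  apply/kerP => //; apply/eqP; rewrite -order_eq1; apply/eqP.
  apply: (@pnat_1 p); last exact: morph_p_elt.
  by apply: mem_p_elt pE _; apply: (subsetP phiE); apply: mem_morphim.
pose C := (phi @* G0)%G.
have tiC : 'ker beta :&: C = 1.
  apply/trivgP/subsetP => y; rewrite inE => /andP[ky /morphimP[x _ G0x xy]].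
  have : alpha x = 1 by rewrite -phib // -xy; apply: mker.
  move=> /= /coset_idr Kx; rewrite xy.
  have /(subsetP sKphi)/mker-> : x \in K; last exact: set11.
  exact/Kx/(subsetP (normal_norm nKG0)).
have bC : beta @* C = beta @* E.
  rewrite bE -aE; apply/setP => y; apply/morphimP/morphimP.
    by case=> _ _ /morphimP[x _ G0x ->] ->; exists x => //; rewrite phib.
  case=> x _ G0x ->; exists (phi x); rewrite ?phib // ?mem_morphim //.
  by apply: (subsetP phiE); apply: mem_morphim.
have iEC : #|E : C| = p.
  rewrite -(index_morphim_ker beta phiE (subxx _)) bC indexgg mul1n.
  rewrite (setIidPr _); last by apply/subsetP=> y /dom_ker.
  by rewrite -divgI tiC cards1 divn1.
pose T := (q @*^-1 C)%G.
have sTP : T \subset P by apply: subsetIl.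
have qT : q @* T = C by rewrite morphpreK.
have iPT : #|P : T| = p.
  rewrite -(index_morphim_ker q sTP (subxx _)) qT iEC.
  have /eqP -> : #|'ker_P q : T| == 1%N; last by rewrite muln1.
  rewrite indexg_eq1; apply: subset_trans (subsetIr _ _) _.
  by rewrite morphpreS // sub1G.
have sQT : Q \subset T.
  by apply: subset_trans (idxp _ sTP iPT); apply: setIS.
have : 'ker beta \subset 'ker beta :&: C.
  by rewrite subsetI subxx /= kerb -qT morphimS.
rewrite tiC => /subset_leq_card; rewrite okb cards1 leqNgt.
by rewrite prime_gt1.
Qed.

From mathcomp Require Import all_classical topology.

Local Open Scope classical_set_scope.
Local Open Scope card_scope.
Local Open Scope group_scope.

(** * Compact spaces *)

Section CompactSpaces.
Variable T : topologicalType.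
Hypothesis compactT : compact [set: T].

Lemma compact_directed_subset (F : set (set T)) (O : set T) :
    F !=set0 -> (forall A, F A -> closed A) ->
    (forall A B, F A -> F B -> exists2 C, F C & C `<=` A `&` B) ->
    open O -> \bigcap_(A in F) A `<=` O ->
  exists2 A, F A & A `<=` O.
Proof.
move=> [A0 FA0] Fclosed Fdir oO FO.
pose Phi := filter_from F (fun A => [set B | F B /\ B `<=` A]).
have Phi_filter : Filter Phi.
  apply: filter_from_filter; first by exists A0.
  move=> A B FA FB; have [C FC CAB] := Fdir A B FA FB.
  by exists C => // D [FD DC]; split; split=> // x /DC/CAB[].
have := (compact_near_coveringP _).1 compactT (set T) Phi
  (fun B x => ~ B x \/ O x) Phi_filter.
case.
  move=> x _; have [Ox|nOx] := pselect (O x).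
    exists (O, setT); first by split; [exact: open_nbhs_nbhs | exact: filterT].
    by move=> [y B] [Oy _]; right.
  have [A FA nAx] : exists2 A, F A & ~ A x.
    apply: contrapT => h; apply/nOx/FO => A FA; apply: contrapT => nAx.
    by apply: h; exists A.
  exists (~` A, [set B | F B /\ B `<=` A]).
    split; last by exists A.
    by apply: open_nbhs_nbhs; split=> //; apply: closed_openC; apply: Fclosed.
  by move=> [y B] [nAy [_ BA]]; left => /BA.
move=> A FA /(_ A) h; exists A => // x Ax.
by have [] := h (conj FA (@subset_refl _ _)) x I.
Qed.

(** In a compact Hausdorff space the intersection Q of the clopen
    neighbourhoods of x is connected: if Q is the disjoint union of closed
    sets A and A' with x in A, normality separates A from A', and some clopen
    neighbourhood of x already lies in the union of the separating open sets;
    its trace on the one around A is clopen again and so contains Q. *)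
Lemma totally_disconnected_zero_dimensional :
  hausdorff_space T -> totally_disconnected [set: T] -> zero_dimensional T.
Proof.
move=> hausT tdT x y /eqP xy.
pose F := [set C : set T | clopen C /\ C x].
pose Q := \bigcap_(C in F) C.
have FQ C : F C -> Q `<=` C by move=> FC z; apply.
suff cQ : connected Q.
  apply: contrapT => h; apply: xy; apply/esym.
  suff : connected_component [set: T] x y by rewrite tdT.
  exists Q; first by split=> // C [].
  by move=> C [clC Cx]; apply: contrapT => nCy; apply: h; exists C.
have clQ : closed Q.
  by apply: closed_bigI => C [[]].
have key (A A' : set T) : closed A -> closed A' -> A `&` A' = set0 ->
    Q `<=` A `|` A' -> A x -> Q `<=` A.
  move=> clA clA' AA' QAA' Ax.
  have [|V /set_nbhsP[U [oU AU UV]] VA'] :=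
      compact_normal hausT compactT clA (_ : set_nbhs A (~` A')).
    apply/set_nbhsP; exists (~` A'); split=> //; first exact: closed_openC.
    by move=> z Az A'z; rewrite -[False]/(set0 z) -AA'.
  have {VA'}UA' : closure U `<=` ~` A'.
    by apply: subset_trans VA'; apply: closureS.
  have [|||||C [[oC cC] Cx] CU] :=
      @compact_directed_subset F (U `|` ~` closure U) _ _ _ _ _.
  - by exists setT; split=> //; apply: clopenT.
  - by move=> C [[]].
  - move=> C D [clC Cx] [clD Dx]; exists (C `&` D) => //.
    by split=> //; apply: clopenI.
  - by apply: openU => //; apply/closed_openC/closed_closure.
  - move=> z /QAA'[/AU|A'z]; [by left|right].
    by move=> /UA'.
  have CUE : C `&` U = C `&` closure U.
    apply/seteqP; split=> z [Cz Uz]; split=> //; first exact: subset_closure.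
    by case: (CU z Cz).
  have FCU : F (C `&` U).
    split; last by split=> //; apply: AU.
    split; first exact: openI.
    by rewrite CUE; apply: closedI => //; apply: closed_closure.
  move=> z Qz; case: (QAA' z Qz) => // A'z.
  by have [_ /subset_closure/UA'] := FQ _ FCU z Qz.
move=> B [b Bb] [C1 oC1 BC1] [C2 cC2 BC2].
have clB : closed B by rewrite BC2; apply: closedI.
have clB' : closed (Q `&` ~` C1).
  by apply: closedI => //; apply: open_closedC.
have BB' : B `&` (Q `&` ~` C1) = set0.
  by apply/seteqP; split=> // z [+ [_ nz]]; rewrite BC1 => -[].
have QBB' : Q `<=` B `|` (Q `&` ~` C1).
  move=> z Qz; rewrite BC1; have [C1z|nC1z] := pselect (C1 z); first by left.
  by right.
have Qx : Q x by move=> C [].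
apply/seteqP; split; first by rewrite BC1 => z [].
case: (QBB' x Qx) => [Bx|B'x]; first exact: key clB clB' BB' QBB' Bx.
have := key _ _ clB' clB; rewrite setIC BB' setUC => /(_ erefl QBB' B'x).
move=> /(_ b); rewrite BC1 in Bb; case: Bb => Qb C1b /(_ Qb)[_].
by move=> /(_ C1b).
Qed.

End CompactSpaces.

(** * Open subgroups of topological groups *)

Lemma subgroupP (G : topologicalGroupType) (H : set G) :
  subgroup H <-> [/\ H 1, forall x y, H x -> H y -> H (x * y)
                        & forall x, H x -> H x^-1].
Proof.
split=> [sH|[H1 HM HV]].
  have HV := group_closedV sH; have HM := group_closedM sH; case: sH => H1 _.
  split; first exact/set_mem/H1.
    by move=> x y Hx Hy; apply/set_mem/HM; apply: mem_set.
  by move=> x Hx; apply/set_mem/HV; apply: mem_set.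
split; first exact: mem_set.
move=> x y /set_mem Hx /set_mem Hy; apply: mem_set.
by apply: HM => //; apply: HV.
Qed.

Section OpenSubgroups.
Variable G : topologicalGroupType.
Implicit Types (H O U : set G) (x y a : G).

Lemma mulg_cvg x y (O : set G) : nbhs (x * y) O ->
  \forall a \near x & b \near y, O (a * b).
Proof.
move=> Oxy; have := @mulg_continuous G (x, y) O Oxy.
by case=> -[A B] [/= nA nB] AB; exists (A, B) => // -[a b] /AB.
Qed.

Lemma mulgl_continuous a : continuous (fun x : G => a * x).
Proof.
move=> x O /mulg_cvg[[A B] [/= nA nB] AB].
rewrite nbhs_simpl /=; apply: filterS nB => b Bb.
by apply: (AB (a, b)); split=> //=; apply: nbhs_singleton.
Qed.

Lemma open_subgroup H : subgroup H -> nbhs 1 H -> open H.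
Proof.
move=> /subgroupP[H1 HM HV] nH; rewrite openE => x Hx.
rewrite /interior; have := @mulgl_continuous x^-1 x H.
rewrite mulVg => /(_ nH); rewrite nbhs_simpl /=; apply: filterS => y /= Hy.
by rewrite -[y](mulKVg x); apply: HM.
Qed.

Lemma open_subgroup_closed H : subgroup H -> open H -> closed H.
Proof.
move=> /subgroupP[H1 HM HV] oH; rewrite -[H]setCK; apply: open_closedC.
rewrite openE => x nHx; rewrite /interior.
have := @mulgl_continuous x^-1 x H; rewrite mulVg.
have nH : nbhs 1 H by apply: open_nbhs_nbhs.
move=> /(_ nH); rewrite nbhs_simpl /=; apply: filterS => y /= Hy Hy'.
apply: nHx; have -> : x = y * (x^-1 * y)^-1 by rewrite invMg invgK mulKVg.
by apply: HM => //; apply: HV.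
Qed.

(** For a clopen C inside O, the v such that right multiplication by v and by
    its inverse map C to itself form a subgroup V, which is a neighbourhood of
    1 because C is compact.  The intersection of the conjugates of V is one
    as well, because G is compact. *)
Lemma open_normal_basis (O : set G) : profinite G -> nbhs 1 O ->
  exists U, [/\ open U, normal_in U [set: G] & U `<=` O].
Proof.
move=> [cG hG tG] nO.
have zG := totally_disconnected_zero_dimensional cG hG tG.
have [C [C1 [oC cC]] CO] := zero_dimensional_cvg hG zG cG nO.
have compC : compact C by apply: subclosed_compact cG _.
pose V := [set v : G | forall c, C c -> C (c * v) /\ C (c * v^-1)].
have sV : subgroup V.
  apply/subgroupP; split.
  - by move=> c Cc; rewrite invg1 mulg1.
  - move=> v w Vv Vw c Cc; split.
      by rewrite mulgA; apply: (Vw _ _).1; apply: (Vv _ _).1.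
    by rewrite invMg mulgA; apply: (Vv _ _).2; apply: (Vw _ _).2.
  - by move=> v Vv c Cc; rewrite invgK; have [] := Vv c Cc.
have nV : nbhs 1 V.
  have near_cov := (compact_near_coveringP C).1 compC.
  have V1 : \forall v \near (1 : G), C `<=` [set c | C (c * v)].
    apply: (near_cov G (nbhs (1 : G)) (fun v c => C (c * v))) => c Cc.
    by apply: mulg_cvg; rewrite mulg1; apply: open_nbhs_nbhs.
  have V2 : \forall v \near (1 : G), C `<=` [set c | C (c * v^-1)].
    have := @invg_continuous G 1 [set v : G | C `<=` [set c | C (c * v)]].
    by rewrite invg1 => /(_ V1).
  by apply: filterS2 V1 V2 => v Cv Cv' c Cc; split; [apply: Cv | apply: Cv'].
have VC : V `<=` C by move=> v /(_ 1 C1)[]; rewrite mul1g.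
have [_ VM VV] := (subgroupP V).1 sV.
pose U := [set v : G | forall g, V (v ^ g)].
have sU : subgroup U.
  apply/subgroupP; split=> [g|v w Uv Uw g|v Uv g].
  - by rewrite conj1g; apply/set_mem/sV.1.
  - by rewrite conjMg; apply: VM.
  - by rewrite conjVg; apply: VV.
have nU : nbhs 1 U.
  suff : \forall v \near (1 : G), [set: G] `<=` [set g | V (v ^ g)].
    by apply: filterS => v Vv g; apply: Vv.
  apply: ((compact_near_coveringP _).1 cG G (nbhs (1 : G))
            (fun v g => V (v ^ g))).
  move=> g _; have : nbhs (g^-1 * (1 * g)) V by rewrite mul1g mulVg.
  case/mulg_cvg => -[A B] [/= nA /mulg_cvg[[D E] [/= nD nE] DEB]] ABV.
  exists (E `&` [set x | A x^-1], D).
    by split=> //=; apply: filterI => //; apply: invg_continuous.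
  move=> [x v] /= [[Ex Ax] Dv]; apply: (ABV (x^-1, v * x)); split=> //=.
  exact: (DEB (v, x)).
exists U; split; first exact: open_subgroup.
  split=> // x y Ux _ g; rewrite -conjgM; exact: Ux.
by move=> v /(_ 1); rewrite conjg1 => /VC/CO.
Qed.

Lemma finite_index H : compact [set: G] -> subgroup H -> open H ->
  exists n, left_cosets [set: G] H #= `I_n.
Proof.
move=> cG /subgroupP[H1 HM HV] oH.
pose cov (s : seq G) := [set x | exists2 y, y \in s & H (y^-1 * x)].
have [|||||_ [s _ <-] sT] := @compact_directed_subset G cG
  [set ~` cov s | s in [set: seq G]] set0.
- by exists (~` cov [::]), [::].
- move=> _ [s _ <-]; apply: open_closedC; rewrite openE => x [y ys Hyx].
  rewrite /interior.
  have := @mulgl_continuous y^-1 x H.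
  have nH : nbhs (y^-1 * x) H by apply: open_nbhs_nbhs.
  by move=> /(_ nH); rewrite nbhs_simpl /=; apply: filterS => z /= Hz; exists y.
- move=> _ _ [s _ <-] [t _ <-]; exists (~` cov (s ++ t)).
    by exists (s ++ t).
  move=> x nx; split=> -[y ys Hy]; apply: nx; exists y => //;
  by rewrite mem_cat ys ?orbT.
- exact: open0.
- move=> x /(_ (~` cov [:: x])); case; first by exists [:: x].
  by exists x; rewrite ?inE // mulVg.
apply/finite_setP.
apply: (@sub_finite_set _ _
  ((fun x => [set x * y | y in H]) @` [set` s])).
  move=> _ [x _ <-]; have [y ys Hyx] : cov s x.
    by apply: contrapT => nx; apply: (sT x).
  exists y => //; apply/seteqP; split=> _ [h Hh <-].
    exists (x^-1 * y * h); last by rewrite !mulgA mulgV mul1g.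
    by apply: HM => //; rewrite -[_ * y]invgK invMg invgK; apply: HV.
  by exists (y^-1 * x * h); rewrite ?mulgA ?mulgV ?mul1g //; apply: HM.
by apply: finite_image; apply: finite_seq.
Qed.

End OpenSubgroups.

(** * Images in finite groups and indices *)

Lemma card_eq_finset (T : finType) (A : {set T}) :
  [set x | x \in A] #= `I_#|A|.
Proof.
have -> : [set x | x \in A] = (@enum_val T (mem A)) @` [set: 'I_#|A|].
  apply/seteqP; split=> [x /= Ax|_ [i _ <-]]; last exact: enum_valP.
  by exists (enum_rank_in Ax x); rewrite // enum_rankK_in.
apply: card_eq_trans (inj_card_eq _) _; last by rewrite card_eq_sym card_II.
by move=> i j _ _; apply: enum_val_inj.
Qed.

Section FiniteImages.
Variables (G : topologicalGroupType) (gT : finGroupType) (f : G -> gT).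
Implicit Types (H N : set G).

(** Taking the generated subgroup makes this a group without any proof about H
    or f; when H is a subgroup and f a morphism it is the image of H, by
    [image_groupP]. *)
Definition image_group H : {group gT} :=
  <<finset (fun y => `[< (f @` H) y >])>>%G.

Hypothesis fM : {morph f : x y / x * y}.

Lemma morph_1 : f 1 = 1.
Proof. by apply: (mulgI (f 1)); rewrite -fM !mulg1. Qed.

Lemma morph_V : {morph f : x / x^-1}.
Proof. by move=> x; apply: (mulgI (f x)); rewrite -fM !mulgV morph_1. Qed.

Lemma morph_J : {morph f : x y / x ^ y}.
Proof. by move=> x y; rewrite /conjg !fM morph_V. Qed.

Lemma image_groupP H y : subgroup H ->
  reflect (exists2 x, H x & f x = y) (y \in image_group H).
Proof.
move=> /subgroupP[H1 HM HV].
have gH : group_set (finset (fun y => `[< (f @` H) y >])).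
  apply/group_setP; split.
    by rewrite inE; apply/asboolP; exists 1; rewrite ?morph_1.
  move=> a b; rewrite !inE => -[x Hx <-] [z Hz <-].
  by exists (x * z); rewrite ?fM //; apply: HM.
rewrite /= (genGid (Group gH)) inE; exact: asboolP.
Qed.

Lemma mem_image_group H x : H x -> f x \in image_group H.
Proof. by move=> Hx; apply: mem_gen; rewrite inE; apply/asboolP; exists x. Qed.

Lemma image_groupS H N : N `<=` H -> image_group N \subset image_group H.
Proof.
move=> NH; apply: genS; apply/fintype.subsetP => y; rewrite !inE.
by move=> -[x /NH Hx <-]; exists x.
Qed.

Lemma card_left_cosets H N : subgroup H -> subgroup N -> N `<=` H ->
    (forall x, H x -> f x = 1 -> N x) ->
  left_cosets H N #= `I_#|image_group H : image_group N|.
Proof.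
move=> sH sN NH kerN; have [N1 NM NV] := (subgroupP N).1 sN.
have [H1 HM HV] := (iffLR (subgroupP H)) sH.
pose d (t : {set gT}) : set G := [set y | H y /\ f y \in t].
have dE x : H x -> d (f x *: image_group N) = [set x * y | y in N].
  move=> Hx; apply/seteqP; split=> [y [Hy]|_ [y Ny <-]].
    rewrite mem_lcoset -morph_V -fM => /(image_groupP _ sN)[n Nn nE].
    exists (x^-1 * y); last by rewrite mulKVg.
    have -> : x^-1 * y = (x^-1 * y * n^-1) * n by rewrite mulgKV.
    apply: NM => //; apply: kerN; last by rewrite fM -nE morph_V mulgV.
    by apply: (HM); [apply: HM => //; apply: HV | apply/HV/NH].
  split; first by apply: HM => //; apply: NH.
  by rewrite fM mem_lcoset mulKg mem_image_group.
have -> : left_cosets H N =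
    d @` [set t | t \in lcosets (image_group N) (image_group H)].
  apply/seteqP; split=> [_ [x Hx <-]|_ [t tH <-]]; last first.
    move: tH => /lcosetsP[_ /(image_groupP _ sH)[x Hx <-] ->].
    by exists x => //; rewrite dE.
  exists (f x *: image_group N); last exact: dE.
  by apply/lcosetsP; exists (f x) => //; apply: mem_image_group.
rewrite -card_lcosets; apply: card_eq_trans (inj_card_eq _) (card_eq_finset _).
move=> t u /set_mem/lcosetsP[a /(image_groupP _ sH)[x Hx <-] ->] /set_mem.
move=> /lcosetsP[b /(image_groupP _ sH)[y Hy <-] ->].
move=> dxy; have : d (f x *: image_group N) x by split=> //; apply: lcoset_refl.
rewrite dxy => -[_ xy]; exact: lcoset_eqP.
Qed.

End FiniteImages.

(** The action on the cosets of H by left multiplication.  Permutations are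
    composed from left to right, so x acts by multiplication by its
    inverse. *)
Lemma coset_action (G : topologicalGroupType) (H : set G) n :
    subgroup H -> left_cosets [set: G] H #= `I_n ->
  exists2 f : G -> {perm 'I_n}, {morph f : x y / x * y} &
    forall x, f x = 1 <-> forall y, H (x ^ y).
Proof.
move=> /subgroupP[H1 HM HV] /card_set_bijP[b [bn binj bsurj]].
have cP (x : G) : (b [set (x * y)%g | y in H] < n)%N by apply: bn; exists x.
pose c (x : G) : 'I_n := Ordinal (cP x).
have cosE x y : H (x^-1 * y) -> [set x * h | h in H] = [set y * h | h in H].
  move=> Hxy; apply/seteqP; split=> _ [h Hh <-].
    exists ((x^-1 * y)^-1 * h); last by rewrite invMg invgK !mulgA mulgV mul1g.
    by apply: HM => //; apply: HV.
  by exists (x^-1 * y * h); rewrite ?mulgA ?mulgV ?mul1g //; apply: HM.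
have cE x y : c x = c y <-> H (x^-1 * y).
  split=> [/(congr1 val)/= bxy|/cosE xy]; last by apply: val_inj; rewrite /= xy.
  have : [set y * h | h in H] y by exists 1; rewrite ?mulg1.
  rewrite -(binj _ _ _ _ bxy).
  - by move=> [h Hh <-]; rewrite mulKg.
  - by apply: mem_set; exists x.
  - by apply: mem_set; exists y.
have /choice[r rK] : forall i : 'I_n, exists x, c x = i.
  move=> i; have [_ [x _ <-] xi] := bsurj i (ltn_ord i).
  by exists x; apply: val_inj.
pose a x i := c (x^-1 * r i).
have aE x z : a x (c z) = c (x^-1 * z).
  apply/cE; rewrite invMg invgK mulgA mulgK; apply/cE; exact: rK.
have aI x : injective (a x).
  move=> i j; rewrite -[i]rK -[j]rK !aE => /cE.
  by rewrite invMg invgK mulgA mulgK => /cE.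
exists (fun x => perm (aI x)) => [x y|x].
  apply/permP => i; rewrite permM !permE -[i]rK !aE.
  by rewrite invMg mulgA.
split=> [x1 y|Hx].
  have : perm (aI x) (c y) = c y by rewrite x1 perm1.
  by rewrite permE aE => /cE; rewrite invMg invgK -mulgA.
apply/permP => i; rewrite permE perm1 -[i]rK aE; apply/cE.
by rewrite invMg invgK -mulgA; apply: Hx.
Qed.

(** * Homomorphisms with open kernel to finite groups *)

Section DiscreteHom.
Variable G : topologicalGroupType.

(** Equivalently, f is a morphism that is continuous for the discrete topology
    on gT. *)
Definition discrete_hom (gT : finGroupType) (f : G -> gT) :=
  {morph f : x y / x * y} /\ nbhs 1 [set x | f x = 1].

Lemma discrete_hom_near (gT : finGroupType) (f : G -> gT) x : discrete_hom f ->
  \forall y \near x, f y = f x.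
Proof.
case=> fM nf; have := @mulgl_continuous G x^-1 x [set x | f x = 1].
rewrite mulVg => /(_ nf); rewrite nbhs_simpl /=; apply: filterS => y /=.
by rewrite fM (morph_V fM) => /(canRL (mulKVg _)); rewrite mulg1.
Qed.

Lemma discrete_hom_open (gT : finGroupType) (f : G -> gT) (A : set gT) :
  discrete_hom f -> open (f @^-1` A).
Proof.
move=> fd; rewrite openE => x Afx; rewrite /interior.
by apply: filterS (discrete_hom_near x fd) => y /= ->.
Qed.

Lemma discrete_hom_closed (gT : finGroupType) (f : G -> gT) (A : set gT) :
  discrete_hom f -> closed (f @^-1` A).
Proof.
move=> fd; rewrite -[A]setCK -preimage_setC.
by apply: open_closedC; apply: discrete_hom_open.
Qed.

Lemma discrete_hom_pair (aT bT : finGroupType) (f : G -> aT) (g : G -> bT) :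
  discrete_hom f -> discrete_hom g -> discrete_hom (fun x => (f x, g x)).
Proof.
move=> [fM nf] [gM ng]; split; first by move=> x y; rewrite fM gM.
by apply: filterS2 nf ng => x /= -> ->.
Qed.

Lemma profinite_discrete_hom (O : set G) : profinite G -> nbhs 1 O ->
  exists n (f : G -> {perm 'I_n}),
    discrete_hom f /\ (forall x, f x = 1 -> O x).
Proof.
move=> prG /(open_normal_basis prG)[U [oU [sU _ nU] UO]].
have cG : compact [set: G] by case: prG.
have [n Un] := finite_index cG sU oU.
have [f fM fU] := coset_action sU Un.
exists n, f; split; first split=> //.
  suff -> : [set x | f x = 1] = U.
    by apply: open_nbhs_nbhs; split=> //; have [] := (subgroupP U).1 sU.
  apply/seteqP; split=> [x /fU/(_ 1)|x Ux]; first by rewrite conjg1.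
  by apply/fU => y; apply: nU.
by move=> x /fU/(_ 1); rewrite conjg1 => /UO.
Qed.

End DiscreteHom.

Lemma subgroupT (G : topologicalGroupType) : subgroup [set: G].
Proof. by apply/subgroupP. Qed.

(** A homomorphism is determined by its values on a finite generating set, so
    the intersection of all the kernels is a finite intersection of open
    sets. *)
Lemma finitely_many_homs (S : topologicalGroupType) (gT : finGroupType) :
    finitely_generated S ->
  nbhs (1 : S) [set x | forall f : S -> gT, discrete_hom f -> f x = 1].
Proof.
move=> [X /finite_seqP[s ->] genX].
have eqS (f g : S -> gT) : discrete_hom f -> discrete_hom g ->
    {in s, f =1 g} -> f =1 g.
  move=> fd gd fg x.
  have sE : subgroup [set x | f x = g x].
    have [[fM _] [gM _]] := (fd, gd).
    apply/subgroupP; split=> [|y z /= fy fz|y /= fy].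
    - by rewrite /= !morph_1.
    - by rewrite fM gM fy fz.
    - by rewrite !morph_V // fy.
  have cE : closed [set x | f x = g x].
    exact: (@discrete_hom_closed _ _ _ [set u | u.1 = u.2]
              (discrete_hom_pair fd gd)).
  have : closure (Defs.generated [set` s]) x by rewrite genX.
  move/(closureS (_ : _ `<=` [set x | f x = g x])).
  rewrite -(iffLR (closure_id _) cE); apply.
  by apply: smallest_sub => // y /fg.
pose K (t : (size s).-tuple gT) := [set x | forall f : S -> gT,
  discrete_hom f -> map f s = t -> f x = 1].
suff : \forall x \near (1 : S), forall t, K t x.
  apply: filterS => x Kx f fd.
  exact: (Kx (map_tuple f (in_tuple s)) f fd).
apply: filter_forall => t.
have [[f [fd ft]]|h] :=
  pselect (exists f : S -> gT, discrete_hom f /\ map f s = t).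
  apply: filterS fd.2 => x /= fx g gd gt; rewrite -fx; apply: eqS => //.
  by apply/eq_in_map; rewrite gt.
by apply: filterS filterT => x _ f fd ft; case: h; exists f.
Qed.

(** * Images of Sylow subgroups *)

Section Sylow.
Variables (G : topologicalGroupType) (p : nat).
Implicit Types (H N P Q T : set G).

Lemma pro_subgroup_image (gT : finGroupType) (f : G -> gT) H (pi : nat_pred) :
  discrete_hom f -> pro_subgroup pi H -> pi.-group (image_group f H).
Proof.
move=> fd [[sH _] /(_ (H `&` [set x | f x = 1]))]; have [fM _] := fd.
have [H1 HM HV] := (subgroupP H).1 sH.
set N := _ `&` _ => proH.
have sN : subgroup N.
  apply/subgroupP; split.
  - by split=> //; apply: morph_1.
  - move=> x y [Hx /= fx] [Hy fy]; split; first exact: HM.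
    by rewrite /= fM fx fy mulg1.
  - by move=> x [Hx /= fx]; split; [apply: HV | rewrite /= morph_V // fx invg1].
have nNH : normal_in N H.
  split=> // [x []|x y [Hx /= fx] Hy] //.
  split; last by rewrite /= morph_J // fx conj1g.
  by apply: (HM); [apply: HV | apply: HM].
have [|n pin cardn] := proH nNH.
  by exists [set x | f x = 1] => //; apply: (discrete_hom_open [set 1] fd).
have : left_cosets H N #= `I_#|image_group f H : image_group f N|.
  by apply: card_left_cosets => // x [].
move/card_esym/card_eq_trans/(_ cardn)/card_eq_II => iE; move: pin; rewrite -iE.
have -> : image_group f N = 1%G; last by rewrite indexg1.
apply/val_inj/trivgP/fintype.subsetP => y.
move=> /(image_groupP fM _ sN)[x [_ /= ->] <-].
exact: set11.
Qed.

Lemma pro_subgroup_of_homs H (pi : nat_pred) :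
    subgroup H -> closed H ->
    (forall N, normal_in N H -> open_in N H ->
      exists (gT : finGroupType) (f : G -> gT),
      [/\ discrete_hom f, forall x, H x -> f x = 1 -> N x &
        pi.-nat #|image_group f H : image_group f N|]) ->
  pro_subgroup pi H.
Proof.
move=> sH cH h; split=> // N nN oN; have [gT [f [[fM _] kf pif]]] := h N nN oN.
exists #|image_group f H : image_group f N| => //.
by case: nN => sN NH _; apply: card_left_cosets.
Qed.

Lemma open_in_discrete_hom H N : profinite G -> subgroup N -> open_in N H ->
  exists n (f : G -> {perm 'I_n}),
    discrete_hom f /\ forall x, H x -> f x = 1 -> N x.
Proof.
move=> prG sN [O oO NO]; have [n [f [fd fO]]] : exists n (f : G -> {perm 'I_n}),
    discrete_hom f /\ (forall x, f x = 1 -> O x).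
  apply: profinite_discrete_hom => //; apply: open_nbhs_nbhs; split=> //.
  by have [] := (subgroupP N).1 sN; rewrite NO => -[].
by exists n, f; split=> // x Hx /fO Ox; rewrite NO.
Qed.

(** For a closed subgroup T of a profinite group this says that T contains a
    Sylow p-subgroup. *)
Definition p'_coindex T := forall (gT : finGroupType) (f : G -> gT),
  discrete_hom f -> p^'%N.-nat #|image_group f [set: G] : image_group f T|.

Lemma subgroup_preimage (gT : finGroupType) (f : G -> gT) T (R : {group gT}) :
    {morph f : x y / x * y} -> subgroup T ->
  subgroup (T `&` f @^-1` [set y | y \in R]).
Proof.
move=> fM /subgroupP[T1 TM TV]; apply/subgroupP; split.
- by split=> //=; rewrite morph_1.
- move=> x y [Tx /= fx] [Ty fy]; split; first exact: TM.
  by rewrite /= fM groupM.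
- by move=> x [Tx /= fx]; split; [apply: TV | rewrite /= morph_V // groupV].
Qed.

(** For another homomorphism h, compare indices in the image of T under the pair
    (f, h).  That of the image of the smaller subgroup T' is the index of R in
    f(T), since T' contains the kernel of f on T, and it is a multiple of the
    index of h(T') in h(T). *)
Lemma p'_coindex_preimage (gT : finGroupType) (f : G -> gT) T (R : {group gT}) :
    discrete_hom f -> subgroup T -> p.-Sylow(image_group f T) R ->
    p'_coindex T -> p'_coindex (T `&` f @^-1` [set y | y \in R]).
Proof.
move=> fd sT sylR coT hT h hd; set T' := _ `&` _.
have fhd := discrete_hom_pair fd hd; set fh := fun x => _ in fhd.
have [[[fM _] [hM _]] [fhM _]] := (fd, hd, fhd).
have sT' : subgroup T' by apply: subgroup_preimage.
have sT'T : T' `<=` T by move=> x [].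
have [sRf _ p'R] := and3P sylR.
rewrite -(Lagrange_index (image_groupS h (@subsetT _ T)) (image_groupS h sT'T)).
rewrite pnatM (coT _ _ hd) /=.
have fstE A : subgroup A -> fst @* image_group fh A = image_group f A.
  move=> sA; apply/setP=> y; apply/morphimP/idP.
    by case=> _ _ /(image_groupP fhM _ sA)[x Ax <-] ->; apply: mem_image_group.
  move=> /(image_groupP fM _ sA)[x Ax <-].
  by exists (fh x); rewrite ?inE //; apply: mem_image_group.
have sndE A : subgroup A -> snd @* image_group fh A = image_group h A.
  move=> sA; apply/setP=> y; apply/morphimP/idP.
    by case=> _ _ /(image_groupP fhM _ sA)[x Ax <-] ->; apply: mem_image_group.
  move=> /(image_groupP hM _ sA)[x Ax <-].
  by exists (fh x); rewrite ?inE //; apply: mem_image_group.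
rewrite -!sndE //; apply: pnat_dvd (index_morphim _ _) _.
  exact: finset.subsetT.
rewrite -(index_morphim_ker [morphism of (@fst gT hT)] (image_groupS fh sT'T))
  ?finset.subsetT //.
rewrite fstE // (fstE T') //.
have -> : image_group f T' = R :> {set gT}.
  apply/setP=> y; apply/(image_groupP fM _ sT')/idP => [[x [_ /= Rx] <-]//|Ry].
  have /(image_groupP fM _ sT)[x Tx xy] := fintype.subsetP sRf y Ry.
  by exists x => //; split=> //=; rewrite xy.
rewrite pnatM p'R /=.
have /eqP -> // : #|'ker_(image_group fh T) [morphism of (@fst gT hT)] :
    image_group fh T'| == 1%N.
rewrite indexg_eq1; apply/fintype.subsetP => y; rewrite inE => /andP[].
move=> /(image_groupP fhM _ sT)[x Tx <-] /mker /= fx1.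
by apply: mem_image_group; split=> //=; rewrite fx1.
Qed.

(** The intersection T of a chain of such subgroups is again of this kind: by
    compactness, for a given f, a member of the chain is contained in the open
    set of the x with f(x) in f(T), and so has the same image as T. *)
Lemma minimal_p'_coindex P : compact [set: G] ->
  exists T, [/\ closed_subgroup T, P `<=` T, p'_coindex T &
    forall T', closed_subgroup T' -> P `<=` T' -> p'_coindex T' ->
      T' `<=` T -> T' = T].
Proof.
move=> cG; pose big T := [/\ closed_subgroup T, P `<=` T & p'_coindex T].
have [|A [bigA maxA]] := @Zorn_bigcup G [set A | big (~` A)]; last first.
  case: (bigA) => clA PA coA; exists (~` A); split=> // T' clT' PT' coT' T'A.
  apply: contrapT => neT'; apply: (maxA (~` T')); last by rewrite /= setCK.
  split; first by move=> x Ax T'x; exact: T'A Ax.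
  move=> /subsetC; rewrite setCK => AT'; apply: neT'.
  by apply/seteqP.
move=> F Fbig Fchain; have [->|/set0P F0] := eqVneq F set0.
  rewrite bigcup_set0 /= setC0; split=> //.
    by split; [exact: subgroupT | exact: closedT].
  by move=> gT f fd; rewrite indexgg.
rewrite /= setC_bigcup; set T := \bigcap_(_ in _) _.
have sT : subgroup T.
  apply/subgroupP; split.
  - by move=> A /Fbig[[/subgroupP[nA _ _] _] _ _].
  - move=> x y Tx Ty A FA; have [[/subgroupP[_ HM _] _] _ _] := Fbig A FA.
    by apply: (HM); [apply: Tx | apply: Ty].
  - move=> x Tx A FA; have [[/subgroupP[_ _ HV] _] _ _] := Fbig A FA.
    by apply: HV; apply: Tx.
split.
- split=> //; apply: closed_bigI => A FA.
  by have [[]] := Fbig A FA.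
- by move=> x Px A /Fbig[_ + _]; apply.
move=> gT f fd; have [fM _] := fd.
have [|||||_ [A FA <-] Af] := @compact_directed_subset G cG [set ~` A | A in F]
  (f @^-1` [set y | y \in image_group f T]).
- by case: F0 => A FA; exists (~` A), A.
- by move=> _ [A FA <-]; have [[]] := Fbig A FA.
- move=> _ _ [A FA <-] [B FB <-].
  have [AB|BA] := Fchain A B FA FB.
    by exists (~` B); [exists B | move=> x nBx; split=> // /AB].
  by exists (~` A); [exists A | move=> x nAx; split=> // /BA].
- exact: discrete_hom_open.
- move=> x Tx; apply: mem_image_group => A FA; apply: Tx; by exists A.
have [[sA _] _ coA] := Fbig A FA.
suff -> : image_group f T = image_group f (~` A) :> {set gT} by apply: coA.
apply/eqP; rewrite finset.eqEsubset.
rewrite image_groupS /=; last by move=> x /(_ A FA).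
by apply/fintype.subsetP => y /(image_groupP fM _ sA)[x /Af + <-].
Qed.

(** A minimal T as in [minimal_p'_coindex] is pro-p: otherwise the preimage of
    a Sylow subgroup of one of its finite images would be smaller.  By
    maximality of P, T is equal to P. *)
Lemma sylow_image (gT : finGroupType) (f : G -> gT) P :
    prime p -> profinite G -> sylow_subgroup p P -> discrete_hom f ->
  p.-Sylow(image_group f [set: G]) (image_group f P).
Proof.
move=> p_pr prG [proP maxP] fd; have [[sP cP] _] := proP.
have [cG _ _] := prG.
have [T [[sT cT] PT coT minT]] := minimal_p'_coindex P cG.
suff TP : T = P.
  apply/and3P; split; first exact: image_groupS.
    exact: pro_subgroup_image proP.
  by rewrite -TP; apply: coT.
apply: maxP => //; split=> // N nN oN.
have [sN NT _] := nN.
have [n [h [hd hN]]] := open_in_discrete_hom prG sN oN.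
have [hM _] := hd.
have [R sylR PR] :=
  Sylow_superset (image_groupS h PT) (pro_subgroup_image hd proP).
pose T' := T `&` h @^-1` [set y | y \in R].
have TT' : T' = T.
  apply: minT.
  - split; first exact: subgroup_preimage.
    by apply: closedI => //; apply: discrete_hom_closed.
  - move=> x Px; split; first exact: PT.
    by apply: (fintype.subsetP PR); apply: mem_image_group.
  - exact: p'_coindex_preimage.
  - by move=> x [].
exists #|image_group h T : image_group h N|; last exact: card_left_cosets.
have pT : p.-group (image_group h T).
  apply: pgroupS (pHall_pgroup sylR).
  apply/fintype.subsetP => y /(image_groupP hM _ sT)[x + <-].
  by rewrite -TT' => -[].
exact: pnat_dvd (dvdn_indexg _ _) pT.
Qed.

End Sylow.

(** * The Frattini subgroup of a finitely generated group *)

(** A subgroup of index p contains the kernel of its coset action, which is a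
    homomorphism to the symmetric group of degree p; there are finitely many
    of these.  Subgroups of index p are presented here as the preimages of
    subgroups M of finite images f(S). *)
Lemma nbhs_in_index_p_subgroups (S : topologicalGroupType) p :
    finitely_generated S ->
  nbhs (1 : S) [set s | forall (gT : finGroupType) (f : S -> gT)
    (M : {group gT}), discrete_hom f ->
    #|image_group f [set: S] : M| = p -> M \subset image_group f [set: S] ->
    f s \in M].
Proof.
move=> /(@finitely_many_homs S {perm 'I_p}); apply: filterS.
move=> s sD gT f M fd iM sM.
have [fM nf] := fd.
pose H := [set: S] `&` f @^-1` [set y | y \in M].
have sH : subgroup H.
  by apply: subgroup_preimage; [exact: fM | exact: subgroupT].
have fH : image_group f H = M :> {set gT}.
  apply/setP=> y; apply/(image_groupP fM _ sH)/idP => [[x [_ /= Mx] <-]//|My].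
  have /(image_groupP fM _ (@subgroupT S))[x _ xy] := fintype.subsetP sM y My.
  by exists x => //; split=> //=; rewrite xy.
have cH : left_cosets [set: S] H #= `I_p.
  rewrite -iM -fH; apply: card_left_cosets => // [|x _ fx].
    exact: subgroupT.
  by split=> //=; rewrite fx group1.
have [u uM uH] := coset_action sH cH.
have ud : discrete_hom u.
  split=> //; apply: filterS nf => x /= fx; apply/uH => y; split=> //=.
  by rewrite morph_J // fx conj1g.
by have /uH/(_ 1) := sD u ud; rewrite conjg1 => -[].
Qed.

Lemma nbhs_of_subgroup (S G : topologicalGroupType) (P : set G) (D : set S)
    (f : S -> G) (g : G -> S) :
    {morph f : x y / x * y} -> {within P, continuous g} -> cancel f g ->
    range f = P -> nbhs 1 D ->
  nbhs 1 [set x | P x -> D (g x)].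
Proof.
move=> fM gC fK rf nD.
have f1 : f 1 = 1 by apply: (mulgI (f 1)); rewrite -fM !mulg1.
have P1 : P 1 by rewrite -rf; exists 1.
have g1 : g 1 = 1 by rewrite -[in LHS]f1 fK.
have nD' : nbhs (g 1) D by rewrite g1.
exact: (subspace_continuousP _ _).1 gC 1 P1 D nD'.
Qed.

(** * Elements of p'-order in all finite quotients *)

Lemma pgroup_elts (pi : nat_pred) (gT : finGroupType) (A : {group gT}) :
  (forall x, x \in A -> pi.-elt x) -> pi.-group A.
Proof.
move=> Api; apply/pgroupP => q q_pr /Cauchy[// | x Ax oq].
by have := Api x Ax; rewrite /p_elt oq pnatE.
Qed.

Lemma p_elt_pair (pi : nat_pred) (aT bT : finGroupType) (a : aT) (b : bT) :
  pi.-elt (a, b) -> pi.-elt a /\ pi.-elt b.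
Proof.
move=> pab; split.
  by apply: (@morph_p_elt _ _ _ (@fst_morphism aT bT) pi (a, b));
    rewrite ?inE.
by apply: (@morph_p_elt _ _ _ (@snd_morphism aT bT) pi (a, b)); rewrite ?inE.
Qed.

Section P'Elements.
Variables (p : nat) (G : topologicalGroupType) (N : set G).
Hypothesis prG : profinite G.
Hypothesis sN : subgroup N.
Hypothesis nN : forall x y, N x -> N (x ^ y).
Hypothesis oN : open N.

Hypothesis p'_generated_pgroup : forall (gT : finGroupType) (h : G -> gT),
  discrete_hom h -> (forall x, h x = 1 -> N x) ->
  p^'%N.-group (p'_generated p (image_group h N)).

(** The limit of the normal p-complements of the finite images of N. *)
Definition p'_elements := [set x | N x /\
  forall (gT : finGroupType) (h : G -> gT), discrete_hom h -> p^'%N.-elt (h x)].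

Lemma p'_elt_hom_M (gT : finGroupType) (h : G -> gT) x y : discrete_hom h ->
    (forall x, h x = 1 -> N x) -> N x -> N y ->
  p^'%N.-elt (h x) -> p^'%N.-elt (h y) -> p^'%N.-elt (h (x * y)).
Proof.
move=> hd hN Nx Ny px py; apply: mem_p_elt (p'_generated_pgroup hd hN) _.
have [hM _] := hd; rewrite hM.
have gen z : N z -> p^'%N.-elt (h z) ->
    h z \in p'_generated p (image_group h N).
  by move=> Nz pz; apply: mem_gen; rewrite inE pz mem_image_group.
by rewrite groupM ?gen.
Qed.

Let exists_hom : exists n (f : G -> {perm 'I_n}),
  discrete_hom f /\ (forall x, f x = 1 -> N x).
Proof.
apply: profinite_discrete_hom => //; apply: open_nbhs_nbhs; split=> //.
by have [] := (subgroupP N).1 sN.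
Qed.

(** The p'-elements of h(N) are known to form a subgroup only when the kernel of
    h lies in N; an arbitrary h is reduced to this case by pairing it with a
    homomorphism whose kernel lies in N. *)
Lemma p'_elements_normal : normal_in p'_elements [set: G].
Proof.
have [N1 NM NV] := (subgroupP N).1 sN.
split=> //; last first.
  move=> x y [Nx px] _; split; first exact: nN.
  by move=> gT h hd; rewrite (morph_J hd.1) /p_elt orderJ; apply: px.
have [n [f [fd fN]]] := exists_hom.
apply/subgroupP; split.
- by split=> // gT h hd; rewrite (morph_1 hd.1) /p_elt order1.
- move=> x y [Nx px] [Ny py]; split; first exact: NM.
  move=> gT h hd; have hfd := discrete_hom_pair hd fd.
  have : p^'%N.-elt (h (x * y), f (x * y)).
    apply: (p'_elt_hom_M hfd) => //; [|exact: px hfd|exact: py hfd].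
    by move=> z [_ /fN].
  by case/p_elt_pair.
- move=> x [Nx px]; split; first exact: NV.
  by move=> gT h hd; rewrite (morph_V hd.1) /p_elt orderV; apply: px.
Qed.

Lemma p'_elements_closed : closed p'_elements.
Proof.
have cN : closed N by apply: open_subgroup_closed.
move=> x clx; split.
  by apply: cN => B /clx[y [[Ny _] By]]; exists y.
move=> gT h hd; have [y [[_ py] /= <-]] := clx _ (discrete_hom_near x hd).
exact: py.
Qed.

Lemma p'_elements_pro : pro_subgroup p^'%N p'_elements.
Proof.
have [sK _ _] := p'_elements_normal.
apply: pro_subgroup_of_homs => //; first exact: p'_elements_closed.
move=> W [sW WK _] oW.
have [n [h [hd hW]]] := open_in_discrete_hom prG sW oW.
exists {perm 'I_n}, h; split=> //; apply: pnat_dvd (dvdn_indexg _ _) _.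
apply: pgroup_elts => y /(image_groupP hd.1 _ sK)[x [_ px] <-].
exact: px.
Qed.

(** Let W be an open normal subgroup of N.  The sets of x in N such that h(x) is
    a p'-element form a directed family of closed sets with intersection 1, so
    one of them lies in W.  Then h(W) contains all p'-elements of h(N), and its
    index divides the order of a p-group. *)
Lemma pro_p_of_trivial_p'_elements : p'_elements = [set 1] -> pro_subgroup p N.
Proof.
move=> K1; have [N1 NM NV] := (subgroupP N).1 sN.
have [cG _ _] := prG.
apply: pro_subgroup_of_homs => //; first exact: open_subgroup_closed.
move=> W [sW WN _] [O oO WO].
have oW : open W by rewrite WO; apply: openI.
have [n [f [fd fN]]] := exists_hom.
pose Kh (gT : finGroupType) (h : G -> gT) := [set x | N x /\ p^'%N.-elt (h x)].
pose F := [set A | exists (gT : finGroupType) (h : G -> gT),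
  [/\ discrete_hom h, forall x, h x = 1 -> N x & A = Kh gT h]].
have [|||||_ [gT [h [hd hN ->]]] KW] := @compact_directed_subset G cG F W.
- by exists (Kh _ f), {perm 'I_n}, f.
- move=> _ [gT [h [hd _ ->]]].
  have -> : Kh gT h = N `&` h @^-1` [set y | p^'%N.-elt y] by [].
  apply: closedI; first exact: open_subgroup_closed.
  exact: discrete_hom_closed.
- move=> _ _ [aT [a [ad aN ->]]] [bT [b [bd bN ->]]].
  exists (Kh _ (fun x => (a x, b x))).
    exists (aT * bT)%type, (fun x => (a x, b x)); split=> //.
      exact: discrete_hom_pair.
    by move=> x [/aN].
  by move=> x [Nx /p_elt_pair[pa pb]].
- exact: oW.
- suff : \bigcap_(A in F) A `<=` p'_elements.
    by rewrite K1 => h x /h ->; have [] := (subgroupP W).1 sW.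
  move=> x Fx; split.
    by have [] : Kh _ f x by apply: Fx; exists {perm 'I_n}, f.
  move=> gT h hd; have [_ px] : Kh _ (fun x => (h x, f x)) x.
    apply: Fx; exists (gT * {perm 'I_n})%type, (fun x => (h x, f x)).
    split=> //.
      exact: discrete_hom_pair.
    by move=> z [_ /fN].
  by case/p_elt_pair: px.
have [hM _] := hd.
exists gT, h; split=> // [x Nx hx|].
  by apply: KW; split=> //; rewrite hx /p_elt order1.
apply: (@pnat_dvd _ #|image_group h N : p'_generated p (image_group h N)|).
  apply: indexgS; rewrite gen_subG; apply/fintype.subsetP => y; rewrite inE.
  move=> /andP[/(image_groupP hM _ sN)[x Nx <-] px].
  by apply/mem_image_group/KW.
rewrite -card_quotient; first exact: p'_generated_quotient.
exact: normal_norm (p'_generated_normal _ (normal_refl _)).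
Qed.

End P'Elements.

(** * The theorem *)

Theorem lemma1p1 (p : nat) (p_prime : prime p) (S : topologicalGroupType)
    (S_pro_p : pro_group p S) (S_fg : finitely_generated S)
    (G : topologicalGroupType) (G_E : class_E p S G) :
  virtually_pro G p.
Proof.
have [prG [P sylP [f [g [fM fC gC fK rf]]]] noK] := G_E.
have nD := nbhs_of_subgroup fM gC fK rf (nbhs_in_index_p_subgroups p S_fg).
have [n [u [ud uD]]] := profinite_discrete_hom prG nD.
have [uM nu] := ud.
pose N := [set x | u x = 1].
have sP : subgroup P by case: sylP => -[[]].
have sN : subgroup N.
  apply/subgroupP; split.
  - exact: morph_1.
  - by move=> x y /= ux uy; rewrite /N /= uM ux uy mulg1.
  - by move=> x /= ux; rewrite /N /= morph_V // ux invg1.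
have nN x y : N x -> N (x ^ y).
  by move=> /= ux; rewrite /N /= morph_J // ux conj1g.
have oN : open N by apply: (discrete_hom_open [set 1] ud).
(* Tate's theorem for h(P) and h(N): if x is in P and h(x) in h(N), then x is in
   N, because N contains the kernel of h, and so x is in the neighbourhood that
   lies in all subgroups of index p. *)
have genN (gT : finGroupType) (h : G -> gT) : discrete_hom h ->
    (forall x, h x = 1 -> N x) ->
    p^'%N.-group (p'_generated p (image_group h N)).
  move=> hd hN; have [hM nh] := hd.
  apply: (Tate_p'_generated p_prime (sylow_image p_prime prG sylP hd)).
    rewrite /normal image_groupS //=; apply/fintype.subsetP => y.
    move=> /(image_groupP hM _ (@subgroupT G))[z _ <-]; rewrite inE.
    apply/fintype.subsetP => _ /imsetP[_ /(image_groupP hM _ sN)[x Nx <-] ->].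
    by rewrite -(morph_J hM); apply: mem_image_group; apply: nN.
  move=> M sM iM; apply/fintype.subsetP => y; rewrite inE => /andP[].
  move=> /(image_groupP hM _ sP)[x Px <-] /(image_groupP hM _ sN)[z Nz zx].
  have ux : u x = 1.
    have : N (x * z^-1) by apply: hN; rewrite hM morph_V // zx mulgV.
    by rewrite /N /= uM morph_V // Nz invg1 mulg1.
  have hfd : discrete_hom (h \o f).
    split; first by move=> a b; rewrite /= fM hM.
    have f1 : f 1 = 1 by apply: (mulgI (f 1)); rewrite -fM !mulg1.
    by have := fC 1 [set x | h x = 1]; rewrite f1 => /(_ nh).
  have hfE : image_group (h \o f) [set: S] = image_group h P :> {set gT}.
    apply/setP => a; apply/idP/idP.
      move=> /(image_groupP hfd.1 _ (@subgroupT S))[s _ <-].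
      by apply: mem_image_group; rewrite -rf; exists s.
    move=> /(image_groupP hM _ sP)[b + <-]; rewrite -rf => -[s _ <-].
    exact: (mem_image_group (h \o f)).
  have := uD x ux Px gT (h \o f) M hfd.
  rewrite hfE => /(_ iM sM) /=.
  by move: Px; rewrite -rf => -[s _ <-]; rewrite fK.
exists N; split=> //; first by split=> // x y Nx _; apply: nN.
apply: pro_p_of_trivial_p'_elements => //; apply: noK.
  exact: p'_elements_normal.
exact: p'_elements_pro.
Qed.
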